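(* Let $d\ge1$, let $R$ be an admissible $\mathrm{eka}^d$ ring with ideal of definition $\mathfrak{a}$, and let $r\ge 1$. Then the topological ring $A=R\langle X_1,\ldots,X_r\rangle_\infty$ is admissible.
   Context: All rings are commutative. $p\ge 2$ is a fixed integer (not necessarily prime). A linearly topologized ring $A$ has an ideal of definition $J$ if $J$ is an open ideal and for every neighborhood $V$ of $0$ there is $n>0$ with $J^n\subset V$. $A$ is admissible if it has an ideal of definition and is separated and complete. $\mathrm{eka}^d$ ring: let $A_0$ be an admissible Noetherian ring with a prescribed maximal ideal of definition generated by a single element $a\in A_0$, such that $a$ has no fractional powers in $A_0$ (no root $a^{1/d^i}$, $i\ge1$, of $a$ lies in $A_0$). The associated $\mathrm{eka}^d$ ring is $A_0[a^{1/d},a^{1/d^2},\ldots]=\varinjlim_i A_0[X]/(X^{d^i}-a)$, obtained by attaching the successive $d$-th power roots of $a$; neighborhoods of $0$ are given by the ideals $(a^n)$, $n\in\mathbb{N}$. For a linearly topologized ring $R$ with fundamental system $(I_\lambda)$ of open ideals, $R[X_1^{1/p^\infty},\ldots,X_r^{1/p^\infty}]:=\bigcup_{i\ge 0}R[X_1^{1/p^i},\ldots,X_r^{1/p^i}]$ and $$R\langle X_1,\ldots,X_r\rangle_\infty:=\varprojlim_\lambda (R/I_\lambda)[X_1^{1/p^\infty},\ldots,X_r^{1/p^\infty}].$$ For $R$ admissible this is the ring of formal series $\sum_\alpha c_\alpha X^\alpha$, $\alpha\in(\mathbb{N}[1/p])^r$ ($\mathbb{N}[1/p]$ = non-negative elements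 of $\mathbb{Z}[1/p]$), $c_\alpha\in R$, $\lim c_\alpha=0$ (every neighborhood of $0$ contains all but finitely many $c_\alpha$), with fundamental neighborhoods of $0$ the sets $V'=\{\sum_\alpha c_\alpha X^\alpha : c_\alpha\in V\ \text{for all }\alpha\}$, $V$ a neighborhood of $0$ in $R$. *)

(* Defs.v *)
From HB Require Import structures.
From mathcomp Require Import all_boot all_order all_algebra.
From mathcomp Require Import finmap all_classical.
From mathcomp Require Import topology.
From mathcomp.multinomials Require Import monalg.

Set Implicit Arguments.
Unset Strict Implicit.
Unset Printing Implicit Defensive.

Import Order.TTheory GRing.Theory Num.Theory.
Local Open Scope classical_set_scope.
Local Open Scope quotient_scope.
Local Open Scope ring_scope.

Section Ideals.
Context {R : comPzRingType}.
Implicit Types (J K : set R) (a : R).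

Definition is_ideal J :=
  [/\ J 0, (forall x y, J x -> J y -> J (x + y))
    & (forall c x, J x -> J (c * x))].

Definition principal_ideal a : set R := [set c * a | c in [set: R]].

Definition generated_ideal (s : seq R) : set R :=
  [set x | exists c : 'I_(size s) -> R, x = \sum_(i < size s) c i * s`_i].

Definition ideal_mul J K : set R :=
  [set x | exists s : seq (R * R),
     (forall u, u \in s -> J u.1 /\ K u.2) /\ x = \sum_(u <- s) u.1 * u.2].

Definition ideal_exp J n : set R := iter n (ideal_mul J) [set: R].

End Ideals.

Definition noetherian (R : comPzRingType) :=
  forall J : set R, is_ideal J -> exists s : seq R, J = generated_ideal s.

#[short(type="preTopologicalComPzRingType")]
HB.structure Definition PreTopologicalComPzRing :=
  {R of GRing.ComPzRing R & Topological R}.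

#[short(type="preTopologicalComNzRingType")]
HB.structure Definition PreTopologicalComNzRing :=
  {R of GRing.ComNzRing R & Topological R}.

Section Admissible.
Variable R : preTopologicalComPzRingType.

Definition linearly_topologized :=
  [/\ continuous (fun z : R * R => z.1 + z.2),
      continuous (fun x : R => - x),
      continuous (fun z : R * R => z.1 * z.2)
    & forall U : set R, nbhs 0 U ->
        exists J : set R, [/\ is_ideal J, open J & J `<=` U]].

Definition ideal_of_definition (J : set R) :=
  [/\ is_ideal J, open J
    & forall V : set R, nbhs 0 V ->
        exists2 n, (0 < n)%N & ideal_exp J n `<=` V].

(* "Maximal ideal of definition" means maximal among the ideals of definition.
   An ideal of definition that is a maximal ideal of the ring is an instance. *)
Definition maximal_ideal_of_definition (J : set R) :=
  ideal_of_definition J /\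
  forall K : set R, ideal_of_definition K -> J `<=` K -> K = J.

(* The library's [cauchy] requires a uniform structure; this is Cauchyness for
   the uniformity that the topology induces on the additive group of R. *)
Definition cauchy_filter (F : set_system R) :=
  forall U : set R, nbhs 0 U ->
    exists2 V : set R, F V & forall x y, V x -> V y -> U (x - y).

Definition complete_ring :=
  forall F : set_system R, ProperFilter F -> cauchy_filter F ->
    exists x : R, F --> x.

Definition admissible :=
  [/\ linearly_topologized, (exists J, ideal_of_definition J),
      hausdorff_space R & complete_ring].

End Admissible.

Record ring_dirsys := RingDirsys {
  dirobj : nat -> comNzRingType;
  dirmap : forall i j, (i <= j)%N -> {rmorphism dirobj i -> dirobj j};
  dirmap_id : forall i (ii : (i <= i)%N) x, dirmap ii x = x;
  dirmap_comp : forall i j k (ij : (i <= j)%N) (jk : (j <= k)%N)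
    (ik : (i <= k)%N) x, dirmap jk (dirmap ij x) = dirmap ik x
}.
Arguments dirmap {_ i j}.
Arguments dirmap_id {_ i}.
Arguments dirmap_comp {_ i j k}.

Section DirectLimit.
Variable S : ring_dirsys.
Local Notation A := (dirobj S).

Definition dirlim_eq : rel {i & A i} := fun x y =>
  `[< exists k (xk : (tag x <= k)%N) (yk : (tag y <= k)%N),
        dirmap xk (tagged x) = dirmap yk (tagged y) >].

Lemma dirlim_eq_equiv : equiv_class_of dirlim_eq.
Proof.
split=> [x|x y|y x z].
- by apply/asboolP; exists (tag x), (leqnn _), (leqnn _).
- by apply/asboolP/asboolP => -[k [xk [yk e]]]; exists k, yk, xk.
move=> /asboolP[k [xk [yk e]]] /asboolP[l [yl [zl e']]]; apply/asboolP.
have km := leq_maxl k l; have lm := leq_maxr k l.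
exists (maxn k l), (leq_trans xk km), (leq_trans zl lm).
rewrite -(dirmap_comp xk km) -(dirmap_comp zl lm) e -e'.
by rewrite (dirmap_comp _ _ (leq_trans yk km)) (dirmap_comp _ _ (leq_trans yk km)).
Qed.

Canonical dirlim_equiv := EquivRelPack dirlim_eq_equiv.
Canonical dirlim_encModRel := defaultEncModRel dirlim_eq.

Definition dirlim := {eq_quot dirlim_eq}.
HB.instance Definition _ : EqQuotient _ dirlim_eq dirlim := EqQuotient.on dirlim.
HB.instance Definition _ := Choice.on dirlim.

Definition dirinj i (x : A i) : dirlim := \pi_dirlim (Tagged A x).

Lemma dirinjP i j (x : A i) (y : A j) :
  dirinj x = dirinj y <->
  exists k (ik : (i <= k)%N) (jk : (j <= k)%N), dirmap ik x = dirmap jk y.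
Proof.
split=> [/eqmodP/asboolP//|h]; exact/eqmodP/asboolP.
Qed.

Lemma dirinj_map i j (ij : (i <= j)%N) (x : A i) :
  dirinj (dirmap ij x) = dirinj x.
Proof.
apply/dirinjP; exists j, (leqnn j), ij.
by rewrite dirmap_id.
Qed.

Lemma dirinj_repr (x : dirlim) : dirinj (tagged (repr x)) = x.
Proof. by rewrite /dirinj -[RHS]reprK; case: (repr x). Qed.

Definition dirlim_op2 (op : forall i, A i -> A i -> A i) (x y : dirlim) :
    dirlim :=
  dirinj (op _ (dirmap (leq_maxl (tag (repr x)) (tag (repr y)))
                       (tagged (repr x)))
               (dirmap (leq_maxr (tag (repr x)) (tag (repr y)))
                       (tagged (repr y)))).

Lemma dirlim_op2E (op : forall i, A i -> A i -> A i) :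
  (forall i j (ij : (i <= j)%N) x y,
     dirmap ij (op i x y) = op j (dirmap ij x) (dirmap ij y)) ->
  forall i (x y : A i), dirlim_op2 op (dirinj x) (dirinj y) = dirinj (op i x y).
Proof.
move=> opM i x y; rewrite /dirlim_op2.
set u := repr (dirinj x); set v := repr (dirinj y).
have /dirinjP[k [uk [ik e]]] : dirinj (tagged u) = dirinj x.
  exact: dirinj_repr.
have /dirinjP[l [vl [il e']]] : dirinj (tagged v) = dirinj y.
  exact: dirinj_repr.
set m := maxn (tag u) (tag v).
set n := maxn m (maxn k l).
have mn : (m <= n)%N by exact: leq_maxl.
have kn : (k <= n)%N by rewrite !leq_max leqnn orbT.
have ln : (l <= n)%N by rewrite !leq_max leqnn !orbT.
have un := leq_trans uk kn.
have vn := leq_trans vl ln.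
have in' := leq_trans ik kn.
apply/dirinjP; exists n, mn, in'; rewrite !opM; congr (op n _ _).
  by rewrite (dirmap_comp _ _ un) -(dirmap_comp uk kn) e (dirmap_comp _ _ in').
by rewrite (dirmap_comp _ _ vn) -(dirmap_comp vl ln) e' (dirmap_comp _ _ in').
Qed.

Lemma dirlim_rep3 (x y z : dirlim) : exists i (a b c : A i),
  [/\ x = dirinj a, y = dirinj b & z = dirinj c].
Proof.
rewrite -(dirinj_repr x) -(dirinj_repr y) -(dirinj_repr z).
set u := repr x; set v := repr y; set w := repr z.
set n := maxn (tag u) (maxn (tag v) (tag w)).
have un : (tag u <= n)%N by rewrite !leq_max leqnn.
have vn : (tag v <= n)%N by rewrite !leq_max leqnn orbT.
have wn : (tag w <= n)%N by rewrite !leq_max leqnn !orbT.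
exists n, (dirmap un (tagged u)), (dirmap vn (tagged v)),
  (dirmap wn (tagged w)).
by rewrite !dirinj_map.
Qed.

Definition dirlim_add := dirlim_op2 (fun i => +%R).
Definition dirlim_mul := dirlim_op2 (fun i => *%R).
Definition dirlim_opp (x : dirlim) : dirlim := dirinj (- tagged (repr x)).

Let addE i (x y : A i) : dirlim_add (dirinj x) (dirinj y) = dirinj (x + y).
Proof. by apply: dirlim_op2E => *; rewrite rmorphD. Qed.

Let mulE i (x y : A i) : dirlim_mul (dirinj x) (dirinj y) = dirinj (x * y).
Proof. by apply: dirlim_op2E => *; rewrite rmorphM. Qed.

Let oppE i (x : A i) : dirlim_opp (dirinj x) = dirinj (- x).
Proof.
rewrite /dirlim_opp.
have /dirinjP[k [uk [ik e]]] := dirinj_repr (dirinj x).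
by apply/dirinjP; exists k, uk, ik; rewrite !rmorphN e.
Qed.

Let zeroE i : dirinj (0 : A 0%N) = dirinj (0 : A i).
Proof. by rewrite -(dirinj_map (leq0n i)) rmorph0. Qed.

Let oneE i : dirinj (1 : A 0%N) = dirinj (1 : A i).
Proof. by rewrite -(dirinj_map (leq0n i)) rmorph1. Qed.

Lemma dirlim_addA : associative dirlim_add.
Proof.
move=> x y z; have [i [a [b [c [-> -> ->]]]]] := dirlim_rep3 x y z.
by rewrite !addE addrA.
Qed.

Lemma dirlim_addC : commutative dirlim_add.
Proof.
move=> x y; have [i [a [b [c [-> -> _]]]]] := dirlim_rep3 x y y.
by rewrite !addE addrC.
Qed.

Lemma dirlim_add0 : left_id (dirinj (0 : A 0%N)) dirlim_add.
Proof.
move=> x; have [i [a [_ [_ [-> _ _]]]]] := dirlim_rep3 x x x.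
by rewrite (zeroE i) addE add0r.
Qed.

Lemma dirlim_addN : left_inverse (dirinj (0 : A 0%N)) dirlim_opp dirlim_add.
Proof.
move=> x; have [i [a [_ [_ [-> _ _]]]]] := dirlim_rep3 x x x.
by rewrite oppE addE addNr (zeroE i).
Qed.

HB.instance Definition _ := GRing.isZmodule.Build dirlim
  dirlim_addA dirlim_addC dirlim_add0 dirlim_addN.

Lemma dirlim_mulA : associative dirlim_mul.
Proof.
move=> x y z; have [i [a [b [c [-> -> ->]]]]] := dirlim_rep3 x y z.
by rewrite !mulE mulrA.
Qed.

Lemma dirlim_mulC : commutative dirlim_mul.
Proof.
move=> x y; have [i [a [b [c [-> -> _]]]]] := dirlim_rep3 x y y.
by rewrite !mulE mulrC.
Qed.

Lemma dirlim_mul1 : left_id (dirinj (1 : A 0%N)) dirlim_mul.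
Proof.
move=> x; have [i [a [_ [_ [-> _ _]]]]] := dirlim_rep3 x x x.
by rewrite (oneE i) mulE mul1r.
Qed.

Lemma dirlim_mulDl : left_distributive dirlim_mul dirlim_add.
Proof.
move=> x y z; have [i [a [b [c [-> -> ->]]]]] := dirlim_rep3 x y z.
by rewrite !(mulE, addE) mulrDl.
Qed.

Lemma dirlim_oner_neq0 : dirinj (1 : A 0%N) != dirinj (0 : A 0%N).
Proof.
apply/eqP => /dirinjP[k [h [h' /eqP]]].
by rewrite rmorph1 rmorph0 oner_eq0.
Qed.

HB.instance Definition _ := GRing.Zmodule_isComNzRing.Build dirlim
  dirlim_mulA dirlim_mulC dirlim_mul1 dirlim_mulDl dirlim_oner_neq0.

End DirectLimit.

Section AdicNbhs.
Variables (R : comPzRingType) (a : R).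

Definition adic_nbhs (x : R) : set_system R :=
  [set U | exists n, forall y, principal_ideal (a ^+ n) (y - x) -> U y].

Lemma adic_nbhs_filter x : ProperFilter (adic_nbhs x).
Proof.
have sub m n y : principal_ideal (a ^+ (m + n)) y -> principal_ideal (a ^+ m) y.
  by move=> [c _ <-]; exists (c * a ^+ n) => //; rewrite -mulrA -exprD addnC.
apply: Build_ProperFilter_ex.
  move=> U [n Un]; exists x; apply: Un; exists 0 => //.
  by rewrite mul0r subrr.
split.
- by exists 0%N.
- move=> P Q [m Pm] [n Qn]; exists (m + n)%N => y h; split.
    exact/Pm/(sub _ n).
  by apply/Qn/(sub _ m); rewrite addnC.
- by move=> P Q PQ [n Pn]; exists n => y /Pn/PQ.
Qed.

Lemma adic_nbhs_singleton x (U : set R) : adic_nbhs x U -> U x.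
Proof. by case=> n; apply; exists 0 => //; rewrite mul0r subrr. Qed.

Lemma adic_nbhs_nbhs x (U : set R) :
  adic_nbhs x U -> adic_nbhs x (adic_nbhs^~ U).
Proof.
case=> n Un; exists n => y [c _ cE]; exists n => z [e _ eE]; apply: Un.
exists (e + c) => //; rewrite mulrDl cE eE; exact: subrKA.
Qed.

End AdicNbhs.

Section Eka.
Variables (d : nat) (d_gt0 : (0 < d)%N) (A0 : comNzRingType) (a : A0).

Definition eka_poly i : {poly A0} := 'X^(d ^ i) - a%:P.

Lemma eka_poly_mk_monic i : mk_monic (eka_poly i) = eka_poly i.
Proof.
have dn : (0 < d ^ i)%N by rewrite expn_gt0 d_gt0.
by rewrite /mk_monic size_XnsubC // monicXnsubC // ltnS dn.
Qed.

Definition eka_step i : comNzRingType := {poly %/ eka_poly i}.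

(* The generator X of the i-th ring is sent to the power X^(d^(j-i)) of the
   generator of the j-th one, both being a^(1/d^i). *)
Definition eka_map i j (ij : (i <= j)%N) (q : eka_step i) : eka_step j :=
  in_qpoly (eka_poly j) ((q : {poly A0}) \Po 'X^(d ^ (j - i))).

Import Pdiv.CommonRing Pdiv.RingMonic.

Lemma eka_poly_comp i j (ij : (i <= j)%N) :
  eka_poly i \Po 'X^(d ^ (j - i)) = eka_poly j.
Proof.
rewrite /eka_poly comp_polyB comp_polyC rmorphXn /= comp_polyX -exprM.
by rewrite -expnD subnK.
Qed.

Lemma eka_map_in i j (ij : (i <= j)%N) (q : {poly A0}) :
  eka_map ij (in_qpoly (eka_poly i) q) =
  in_qpoly (eka_poly j) (q \Po 'X^(d ^ (j - i))).
Proof.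
rewrite /eka_map /=.
rewrite [in RHS](rdivp_eq (monic_mk_monic (eka_poly i)) q).
rewrite comp_polyD comp_polyM eka_poly_mk_monic (eka_poly_comp ij).
rewrite in_qpolyD in_qpolyM.
suff -> : in_qpoly (eka_poly j) (eka_poly j) = 0 by rewrite mulr0 add0r.
by apply: val_inj; rewrite /= eka_poly_mk_monic rmodpp // -eka_poly_mk_monic
  monic_mk_monic.
Qed.

Lemma eka_in i (q : eka_step i) : in_qpoly (eka_poly i) (q : {poly A0}) = q.
Proof. by apply: val_inj; apply: in_qpoly_small; apply: size_mk_monic. Qed.

Lemma eka_map_zmod i j (ij : (i <= j)%N) : zmod_morphism (eka_map ij).
Proof.
move=> x y; rewrite /eka_map -[RHS]raddfB -comp_polyB.
by congr (in_qpoly _ (_ \Po _)).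
Qed.

Lemma eka_map_monoid i j (ij : (i <= j)%N) : monoid_morphism (eka_map ij).
Proof.
split=> [|x y]; first by rewrite -[1](in_qpoly1 (eka_poly i)) eka_map_in
  comp_polyC in_qpoly1.
by rewrite -[x]eka_in -[y]eka_in -in_qpolyM !eka_map_in comp_polyM in_qpolyM.
Qed.

HB.instance Definition _ i j (ij : (i <= j)%N) :=
  GRing.isZmodMorphism.Build (eka_step i) (eka_step j) (eka_map ij)
    (eka_map_zmod ij).
HB.instance Definition _ i j (ij : (i <= j)%N) :=
  GRing.isMonoidMorphism.Build (eka_step i) (eka_step j) (eka_map ij)
    (eka_map_monoid ij).

Lemma eka_map_id i (ii : (i <= i)%N) x : eka_map ii x = x.
Proof. by rewrite /eka_map subnn expr1 comp_polyXr eka_in. Qed.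

Lemma eka_map_comp i j k (ij : (i <= j)%N) (jk : (j <= k)%N) (ik : (i <= k)%N)
  x : eka_map jk (eka_map ij x) = eka_map ik x.
Proof.
rewrite [eka_map ij x]/eka_map eka_map_in /eka_map -comp_polyA.
rewrite rmorphXn /= comp_polyX -exprM -expnD; do 4!f_equal.
by rewrite addnBA // subnK.
Qed.

Definition eka_dirsys : ring_dirsys :=
  @RingDirsys eka_step (fun i j ij => eka_map ij) eka_map_id eka_map_comp.

(* The topology on this ring, below, is the one given by the ideals (a^n). *)
Definition eka := dirlim eka_dirsys.
HB.instance Definition _ := GRing.ComNzRing.on eka.

Definition eka_of (c : A0) : eka :=
  @dirinj eka_dirsys 0 (qpolyC (eka_poly 0) c).

HB.instance Definition _ := hasNbhs.Build eka (adic_nbhs (eka_of a)).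
HB.instance Definition _ := Nbhs_isNbhsTopological.Build eka
  (adic_nbhs_filter (eka_of a)) (@adic_nbhs_singleton _ (eka_of a))
  (@adic_nbhs_nbhs _ (eka_of a)).

End Eka.

(* For d = 1 every root a^(1/d^i) is a itself, which is not a fractional power,
   and the condition is void: an eka^1 ring is A0 with the a-adic topology. *)
Definition no_fractional_powers (d : nat) (R : comNzRingType) (a : R) :=
  (1 < d)%N -> forall (i : nat) (b : R), (1 <= i)%N -> b ^+ (d ^ i) <> a.

Definition eka_datum (d : nat) (A0 : preTopologicalComNzRingType) (a : A0) :=
  [/\ admissible A0, noetherian A0,
      maximal_ideal_of_definition (principal_ideal a)
    & no_fractional_powers d a].

Section Exponents.
Variable p : nat.

(* q lies in Z[1/p] exactly when some q * p^i is an integer (p <> 0). *)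
Definition Nfrac_pred : pred rat := fun q =>
  (0 <= q) && `[< exists i : nat, q * p%:R ^+ i \is a Num.int >].

Definition Nfrac := {q : rat | Nfrac_pred q}.
HB.instance Definition _ := Choice.on Nfrac.

Lemma Nfrac_pred0 : Nfrac_pred 0.
Proof. by rewrite /Nfrac_pred lexx; apply/asboolP; exists 0%N; rewrite mul0r. Qed.

Lemma Nfrac_predD x y : Nfrac_pred x -> Nfrac_pred y -> Nfrac_pred (x + y).
Proof.
move=> /andP[x0 /asboolP[i xi]] /andP[y0 /asboolP[j yj]].
rewrite /Nfrac_pred addr_ge0 //; apply/asboolP; exists (i + j)%N.
have pX k : p%:R ^+ k \is a @Num.int rat by rewrite rpredX // rpred_nat.
have -> : (x + y) * p%:R ^+ (i + j) =
    x * p%:R ^+ i * p%:R ^+ j + y * p%:R ^+ j * p%:R ^+ i.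
  by rewrite exprD mulrDl !mulrA [y * _ * _]mulrAC.
by rewrite rpredD // rpredM.
Qed.

Definition Nfrac0 : Nfrac := exist _ 0 Nfrac_pred0.
Definition Nfrac_add (x y : Nfrac) : Nfrac :=
  exist _ (val x + val y) (Nfrac_predD (valP x) (valP y)).

Variable r : nat.

(* The monoid N[1/p]^r of exponents, written multiplicatively as in monalg:
   the product of two exponents is their sum, and 1 is the zero exponent. *)
Definition exponent := {ffun 'I_r -> Nfrac}.
HB.instance Definition _ := Choice.on exponent.

Definition exponent_one : exponent := [ffun=> Nfrac0].
Definition exponent_mul (u v : exponent) : exponent :=
  [ffun i => Nfrac_add (u i) (v i)].

Lemma exponent_mulA : associative exponent_mul.
Proof.
by move=> u v w; apply/ffunP => i; rewrite !ffunE; apply: val_inj; rewrite /= addrA.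
Qed.

Lemma exponent_mulC : commutative exponent_mul.
Proof.
by move=> u v; apply/ffunP => i; rewrite !ffunE; apply: val_inj; rewrite /= addrC.
Qed.

Lemma exponent_mul1m : left_id exponent_one exponent_mul.
Proof.
by move=> u; apply/ffunP => i; rewrite !ffunE; apply: val_inj; rewrite /= add0r.
Qed.

Lemma exponent_mulm1 : right_id exponent_one exponent_mul.
Proof. by move=> u; rewrite exponent_mulC exponent_mul1m. Qed.

Lemma exponent_unitm u v :
  exponent_mul u v = exponent_one -> u = exponent_one /\ v = exponent_one.
Proof.
move=> uv1; suff uv i : val (u i) = 0 /\ val (v i) = 0.
  by split; apply/ffunP => i; rewrite ffunE; apply: val_inj; case: (uv i).
have /(congr1 val) /= /eqP : exponent_mul u v i = exponent_one i by rewrite uv1.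
have /andP[u0 _] := valP (u i); have /andP[v0 _] := valP (v i).
by rewrite !ffunE /= paddr_eq0 // => /andP[/eqP -> /eqP ->].
Qed.

HB.instance Definition _ := Choice_isMonomialDef.Build exponent
  exponent_mulA exponent_mul1m exponent_mulm1 exponent_unitm.
HB.instance Definition _ :=
  MonomialDef_isConomialDef.Build exponent exponent_mulC.

End Exponents.

(* R[X_1^(1/p^oo), ..., X_r^(1/p^oo)]: the union of the polynomial rings
   R[X_1^(1/p^i), ..., X_r^(1/p^i)] consists of the finite R-linear combinations
   of the monomials X^alpha with alpha in N[1/p]^r. *)
Definition frac_mpoly (p r : nat) (R : comNzRingType) : comNzRingType :=
  {malg R[exponent p r]}.

Section MalgMap.
Variables (M : conomType) (R T : comNzRingType) (f : {rmorphism R -> T}).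

Definition malg_map (g : {malg R[M]}) : {malg T[M]} :=
  [malg k in msupp g => f g@_k].

Lemma malg_mapE g k : (malg_map g)@_k = f g@_k.
Proof. by rewrite mcoeffE; case: msuppP => //; rewrite rmorph0. Qed.

Lemma malg_map_zmod : zmod_morphism malg_map.
Proof. by move=> g h; apply/malgP => k; rewrite !(malg_mapE, mcoeffB) rmorphB. Qed.

Lemma malg_map_monoid : monoid_morphism malg_map.
Proof.
split=> [|g h]; apply/malgP => k.
  by rewrite malg_mapE !mcoeff1 rmorph_nat.
have sub g' : (msupp (malg_map g') `<=` msupp g')%fset.
  apply/fsubsetP => l; rewrite -!mcoeff_neq0 malg_mapE.
  by apply: contra_neq => ->; rewrite rmorph0.
rewrite malg_mapE (mcoeffMlw _ (sub g) (sub h)) mcoeffMl rmorph_sum /=.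
apply: eq_bigr => k1 _; rewrite rmorph_sum /=; apply: eq_bigr => k2 _.
by rewrite rmorphMn rmorphM /= !malg_mapE.
Qed.

HB.instance Definition _ :=
  GRing.isZmodMorphism.Build {malg R[M]} {malg T[M]} malg_map malg_map_zmod.
HB.instance Definition _ :=
  GRing.isMonoidMorphism.Build {malg R[M]} {malg T[M]} malg_map malg_map_monoid.

End MalgMap.

Section QuotientMap.
Variables (R : comNzRingType) (I J : idealr R) (IJ : {subset I <= J}).

Definition quot_map (x : {ideal_quot I}) : {ideal_quot J} :=
  \pi_{ideal_quot J} (repr x).

Lemma quot_map_pi x :
  quot_map (\pi_{ideal_quot I} x) = \pi_{ideal_quot J} x.
Proof.
apply/eqP; rewrite -Quotient.idealrBE; apply: IJ.
by rewrite Quotient.idealrBE reprK.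
Qed.

Lemma quot_map_zmod : zmod_morphism quot_map.
Proof.
move=> x y; rewrite -[x]reprK -[y]reprK -rmorphB !quot_map_pi.
by rewrite rmorphB.
Qed.

Lemma quot_map_monoid : monoid_morphism quot_map.
Proof.
split=> [|x y]; first by rewrite -(rmorph1 (\pi_{ideal_quot I})) quot_map_pi rmorph1.
by rewrite -[x]reprK -[y]reprK -rmorphM !quot_map_pi rmorphM.
Qed.

End QuotientMap.

Record ring_invsys (L : Type) := RingInvsys {
  inv_le : L -> L -> Prop;
  invobj : L -> comPzRingType;
  invmap : forall l m, inv_le l m -> {rmorphism invobj m -> invobj l}
}.
Arguments inv_le {L} _.
Arguments invobj {L} _.
Arguments invmap {L _ l m}.

Section InverseLimit.
Variables (L : Type) (S : ring_invsys L).
Local Notation P := (invobj S).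

Record invlim_ring := InvlimRing {
  component :> forall l, P l;
  component_compat : forall l m (lm : inv_le S l m),
    invmap lm (component m) = component l
}.

HB.instance Definition _ := gen_eqMixin invlim_ring.
HB.instance Definition _ := gen_choiceMixin invlim_ring.

Lemma invlimP (x y : invlim_ring) : (forall l, x l = y l) -> x = y.
Proof.
case: x y => [x cx] [y cy] /= xy.
have e : x = y by exact: functional_extensionality_dep.
by case: _ / e cy {xy} => cy; congr InvlimRing; exact: Prop_irrelevance.
Qed.

Fact invlim_zero_compat l m (lm : inv_le S l m) : invmap lm 0 = 0.
Proof. exact: rmorph0. Qed.
Fact invlim_one_compat l m (lm : inv_le S l m) : invmap lm 1 = 1.
Proof. exact: rmorph1. Qed.
Fact invlim_opp_compat (x : invlim_ring) l m (lm : inv_le S l m) :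
  invmap lm (- x m) = - x l.
Proof. by rewrite rmorphN /= component_compat. Qed.
Fact invlim_add_compat (x y : invlim_ring) l m (lm : inv_le S l m) :
  invmap lm (x m + y m) = x l + y l.
Proof. by rewrite rmorphD /= !component_compat. Qed.
Fact invlim_mul_compat (x y : invlim_ring) l m (lm : inv_le S l m) :
  invmap lm (x m * y m) = x l * y l.
Proof. by rewrite rmorphM /= !component_compat. Qed.

Definition invlim_zero := InvlimRing invlim_zero_compat.
Definition invlim_one := InvlimRing invlim_one_compat.
Definition invlim_opp (x : invlim_ring) := InvlimRing (invlim_opp_compat x).
Definition invlim_add (x y : invlim_ring) := InvlimRing (invlim_add_compat x y).
Definition invlim_mul (x y : invlim_ring) := InvlimRing (invlim_mul_compat x y).

Lemma invlim_addA : associative invlim_add.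
Proof. by move=> x y z; apply: invlimP => l /=; rewrite addrA. Qed.
Lemma invlim_addC : commutative invlim_add.
Proof. by move=> x y; apply: invlimP => l /=; rewrite addrC. Qed.
Lemma invlim_add0 : left_id invlim_zero invlim_add.
Proof. by move=> x; apply: invlimP => l /=; rewrite add0r. Qed.
Lemma invlim_addN : left_inverse invlim_zero invlim_opp invlim_add.
Proof. by move=> x; apply: invlimP => l /=; rewrite addNr. Qed.

HB.instance Definition _ := GRing.isZmodule.Build invlim_ring
  invlim_addA invlim_addC invlim_add0 invlim_addN.

Lemma invlim_mulA : associative invlim_mul.
Proof. by move=> x y z; apply: invlimP => l /=; rewrite mulrA. Qed.
Lemma invlim_mulC : commutative invlim_mul.
Proof. by move=> x y; apply: invlimP => l /=; rewrite mulrC. Qed.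
Lemma invlim_mul1 : left_id invlim_one invlim_mul.
Proof. by move=> x; apply: invlimP => l /=; rewrite mul1r. Qed.
Lemma invlim_mul1r : right_id invlim_one invlim_mul.
Proof. by move=> x; apply: invlimP => l /=; rewrite mulr1. Qed.
Lemma invlim_mulDl : left_distributive invlim_mul invlim_add.
Proof. by move=> x y z; apply: invlimP => l /=; rewrite mulrDl. Qed.
Lemma invlim_mulDr : right_distributive invlim_mul invlim_add.
Proof. by move=> x y z; apply: invlimP => l /=; rewrite mulrDr. Qed.

HB.instance Definition _ := GRing.Zmodule_isPzRing.Build invlim_ring
  invlim_mulA invlim_mul1 invlim_mul1r invlim_mulDl invlim_mulDr.
HB.instance Definition _ :=
  GRing.PzRing_hasCommutativeMul.Build invlim_ring invlim_mulC.

(* The limit topology: that induced by the product of the discrete topologies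
   on the rings of the system. *)
Definition invlim : Type := initial_topology
  (fun x : invlim_ring =>
     component x : prod_topology (fun l => discrete_topology (P l))).

HB.instance Definition _ := Topological.on invlim.
HB.instance Definition _ := GRing.ComPzRing.copy invlim invlim_ring.

End InverseLimit.

Section FracSeries.
Variables (p r : nat) (R : comNzRingType) (L : Type) (I : L -> idealr R).

Definition frac_series_le (l m : L) : Prop := {subset I m <= I l}.

Definition frac_series_obj (l : L) : comPzRingType :=
  frac_mpoly p r {ideal_quot (I l)}.

Definition quot_rmorphism l m (lm : frac_series_le l m) :
    {rmorphism {ideal_quot (I m)} -> {ideal_quot (I l)}} :=
  HB.pack (@quot_map R (I m) (I l))
    (GRing.isZmodMorphism.Build _ _ _ (quot_map_zmod lm))
    (GRing.isMonoidMorphism.Build _ _ _ (quot_map_monoid lm)).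

Definition frac_series_sys : ring_invsys L :=
  @RingInvsys L frac_series_le frac_series_obj
    (fun l m lm => malg_map (quot_rmorphism lm)).

Definition frac_series := invlim frac_series_sys.
HB.instance Definition _ := GRing.ComPzRing.on frac_series.
HB.instance Definition _ := Topological.on frac_series.

End FracSeries.

(* The quotients R / I_l must be nontrivial rings here, so the ideals of the
   system are proper; discarding the unit ideal does not change the limit. *)
Definition fundamental_system (R : preTopologicalComNzRingType) (L : Type)
    (I : L -> idealr R) :=
  (forall l, open [set x : R | x \in I l]) /\
  (forall U : set R, nbhs 0 U -> exists l, [set x : R | x \in I l] `<=` U).

(* Main.v *)
(* The series ring is a limit of discrete rings over a directed system, hence
   linearly topologized, separated and complete.  If [fa] is an ideal of
   definition of R and I_l is contained in [fa], the kernel of the projection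
   onto the l-th component is an ideal of definition: in each component m with
   I_m contained in I_l, the coefficients of its elements lift to [fa], so those
   of its n-th power lift to [fa]^n, which for n large lies in any prescribed
   open ideal. *)
Require Import Defs.
From mathcomp Require Import all_boot all_order all_algebra.
From mathcomp Require Import all_classical.
From mathcomp Require Import topology.
From mathcomp.multinomials Require Import monalg.

Set Implicit Arguments.
Unset Strict Implicit.
Unset Printing Implicit Defensive.

Import GRing.Theory.
Local Open Scope classical_set_scope.
Local Open Scope quotient_scope.
Local Open Scope ring_scope.

Lemma ideal_mul0 (R : comPzRingType) (J K : set R) : ideal_mul J K 0.
Proof. by exists [::]; rewrite big_nil. Qed.

Lemma ideal_mulD (R : comPzRingType) (J K : set R) x y :
  ideal_mul J K x -> ideal_mul J K y -> ideal_mul J K (x + y).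
Proof.
move=> [s [sJK ->]] [t [tJK ->]]; exists (s ++ t); rewrite big_cat; split=> //.
by move=> u; rewrite mem_cat => /orP[/sJK|/tJK].
Qed.

Lemma ideal_mulM (R : comPzRingType) (J K : set R) x y :
  J x -> K y -> ideal_mul J K (x * y).
Proof.
move=> Jx Ky; exists [:: (x, y)]; rewrite big_seq1; split=> // u.
by rewrite inE => /eqP ->.
Qed.

Section InverseLimitTopology.
Variables (L : Type) (S : ring_invsys L).
Hypothesis L_inhabited : inhabited L.
Hypothesis S_directed : forall l m, exists k, inv_le S l k /\ inv_le S m k.

(** The coset of [x] modulo the kernel of the projection to component [l]. *)
Definition invlim_ball (x : invlim S) (l : L) : set (invlim S) :=
  [set y | component y l = component x l].

Lemma invlim_ball_mono x l m :
  inv_le S l m -> invlim_ball x m `<=` invlim_ball x l.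
Proof.
by move=> lm y yx; rewrite /invlim_ball /= -!(component_compat _ lm) yx.
Qed.

Lemma invlim_ball_open x l : open (invlim_ball x l).
Proof.
pose T := prod_topology (fun l => discrete_topology (invobj S l)).
exists [set f : T | f l = component x l] => //; rewrite openE => f fl.
(* The product topology is the supremum of the topologies pulled back along the coordinates, so a
   neighborhood for coordinate [l] alone suffices. *)
have /cvg_sup/(_ l) : nbhs f --> f by [].
apply; exists [set g : T | g l = component x l]; split=> //.
by exists [set component x l] => //; exact: discrete_open.
Qed.

(** Directedness replaces finitely many conditions on components by a single one, so the balls
    around [x] form a filter base. *)
Lemma nbhs_invlimP (x : invlim S) (U : set (invlim S)) :
  nbhs x U <-> exists l, invlim_ball x l `<=` U.
Proof.
split; last first.
  move=> [l lU]; apply: filterS lU _; apply: open_nbhs_nbhs.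
  by split=> //; exact: invlim_ball_open.
pose F := filter_from [set: L] (invlim_ball x).
have FF : Filter F.
  apply: filter_from_filter; first by case: L_inhabited => l; exists l.
  move=> l m _ _; have [k [lk mk]] := S_directed l m; exists k => // y xy.
  by split; [exact: (invlim_ball_mono lk)|exact: (invlim_ball_mono mk)].
pose T := prod_topology (fun l => discrete_topology (invobj S l)).
pose f (y : invlim S) : T := component y.
(* Convergence in the product is checked coordinatewise, and on the ball of index [l] coordinate [l]
   is constant. *)
have Fx : f @ F --> f x.
  apply/cvg_sup => l A [_ [[B _ <-] Bx] BA].
  by exists l => // y yx; apply: BA; rewrite /= /f yx.
move=> [_ [[B Bop <-] Bx] BU].
have [|l _ lB] := Fx B; first exact: open_nbhs_nbhs.
by exists l => y /lB/BU.
Qed.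

Lemma invlim_ball_ideal l : is_ideal (invlim_ball 0 l).
Proof.
split=> [//|x y|c x]; rewrite /invlim_ball /=.
  by move=> -> ->; exact: addr0.
by move=> ->; exact: mulr0.
Qed.

Lemma invlim_linearly_topologized : linearly_topologized (invlim S).
Proof.
split.
- move=> [x y] U /nbhs_invlimP[l lU].
  exists (invlim_ball x l, invlim_ball y l).
    by split; apply/nbhs_invlimP; exists l.
  by move=> [u v] [/= ux vy]; apply: lU; rewrite /invlim_ball /= ux vy.
- move=> x U /nbhs_invlimP[l lU]; apply/nbhs_invlimP; exists l => y yx.
  by apply: lU; rewrite /invlim_ball /= yx.
- move=> [x y] U /nbhs_invlimP[l lU].
  exists (invlim_ball x l, invlim_ball y l).
    by split; apply/nbhs_invlimP; exists l.
  by move=> [u v] [/= ux vy]; apply: lU; rewrite /invlim_ball /= ux vy.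
- move=> U /nbhs_invlimP[l lU]; exists (invlim_ball 0 l); split=> //.
    exact: invlim_ball_ideal.
  exact: invlim_ball_open.
Qed.

Lemma invlim_hausdorff : hausdorff_space (invlim S).
Proof.
move=> x y xy; apply: invlimP => l.
have [||z [/= <- ->//]] := xy (invlim_ball x l) (invlim_ball y l).
  by apply/nbhs_invlimP; exists l.
by apply/nbhs_invlimP; exists l.
Qed.

(** Modulo each open kernel a Cauchy filter is eventually constant; these constants are the
    components of its limit. *)
Lemma invlim_complete : complete_ring (invlim S).
Proof.
move=> F FF Fcauchy.
have exc l : exists c, F [set x | component x l = c].
  have [|V FV Vl] := Fcauchy (invlim_ball 0 l).
    by apply/nbhs_invlimP; exists l.
  have [v Vv] := filter_ex FV; exists (component v l).
  by apply: filterS FV => x Vx; apply/eqP; rewrite -subr_eq0; apply/eqP/Vl.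
pose c l := projT1 (cid (exc l)).
have Fc l : F [set x | component x l = c l] := projT2 (cid (exc l)).
have cE l m (lm : inv_le S l m) : invmap lm (c m) = c l.
  (* Two sets of a proper filter meet, and a common point has both constants as components. *)
  have [x [<- <-]] := filter_ex (filterI (Fc l) (Fc m)).
  exact: component_compat.
exists (InvlimRing cE : invlim S) => U /nbhs_invlimP[l lU].
exact: filterS lU (Fc l).
Qed.

End InverseLimitTopology.

(** * Coefficients of fractional power series and the ideal of definition *)

Section FracSeriesAdmissible.
Variables (p r : nat) (R : preTopologicalComNzRingType) (L : Type).
Variable I : L -> idealr R.
Hypothesis I_fund : fundamental_system I.
Local Notation A := (frac_series p r I).
Local Notation sys := (frac_series_sys p r I).

Lemma fundamental_nbhs l : nbhs (0 : R) [set x | x \in I l].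
Proof.
by apply: open_nbhs_nbhs; split; [exact: I_fund.1|rewrite /= idealr0].
Qed.

Lemma fundamental_inhabited : inhabited L.
Proof. by have [l _] := I_fund.2 _ filterT; exists. Qed.

Lemma fundamental_directed l m : exists k, inv_le sys l k /\ inv_le sys m k.
Proof.
have [k kE] := I_fund.2 _ (filterI (fundamental_nbhs l) (fundamental_nbhs m)).
by exists k; split=> x /kE[].
Qed.

Definition frac_coef (x : A) (l : L) k : {ideal_quot (I l)} :=
  mcoeff k (component x l : {malg {ideal_quot (I l)}[exponent p r]}).

Lemma frac_coef_compat (x : A) l m (lm : inv_le sys l m) k c :
  frac_coef x m k = \pi c -> frac_coef x l k = \pi c.
Proof.
rewrite /frac_coef -(component_compat x lm) malg_mapE => ->.
exact: quot_map_pi.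
Qed.

(** Induction on [n], then on the length of the sum of products: a coefficient of a product is a
    finite sum of products of coefficients, and lifts multiply. *)
Lemma frac_coef_ideal_exp (fa : set R) l m (lm : inv_le sys l m) n x k :
  [set c | c \in I l] `<=` fa ->
  ideal_exp (@invlim_ball L sys 0 l) n x ->
  exists2 c, ideal_exp fa n c & frac_coef x m k = \pi c.
Proof.
move=> lfa; elim: n x k => [|n IHn] x k.
  (* The zeroth power is the whole ring, so any representative will do. *)
  by move=> _; exists (repr (frac_coef x m k)); rewrite ?reprK.
move=> [s [sJ ->{x}]].
elim: s sJ => [|u s IHs] sJ.
  rewrite big_nil; exists 0; first exact: ideal_mul0.
  by rewrite /frac_coef mcoeff0 rmorph0.
have [|c cfa cE] := IHs; first by move=> v vs; apply: sJ; rewrite inE vs orbT.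
have [/= u1 u2] := sJ u (mem_head _ _).
suff [b bfa bE] : exists2 b, ideal_exp fa n.+1 b &
    frac_coef (u.1 * u.2) m k = \pi b.
  rewrite big_cons; exists (b + c); first exact: ideal_mulD.
  by rewrite rmorphD /= -bE -cE /frac_coef -mcoeffD.
(* Component [l] of [u.1] vanishes, so every representative of a coefficient at level [m] lies in
   [I l], hence in [fa]. *)
have {}u1 j : exists2 b, fa b & frac_coef u.1 m j = \pi b.
  exists (repr (frac_coef u.1 m j)); last by rewrite reprK.
  apply: lfa; rewrite /= -[repr _]subr0 Quotient.idealrBE rmorph0.
  have <- := frac_coef_compat lm (esym (reprK (frac_coef u.1 m j))).
  by rewrite /frac_coef u1 mcoeff0.
rewrite /frac_coef /= mcoeffMl.
apply: (big_ind (fun y => exists2 b, _ b & y = \pi b)).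
- by exists 0; [exact: ideal_mul0|rewrite rmorph0].
- move=> _ _ [b bfa ->] [e efa ->]; exists (b + e); first exact: ideal_mulD.
  by rewrite rmorphD.
move=> i _; apply: (big_ind (fun y => exists2 b, _ b & y = \pi b)).
- by exists 0; [exact: ideal_mul0|rewrite rmorph0].
- move=> _ _ [b bfa ->] [e efa ->]; exists (b + e); first exact: ideal_mulD.
  by rewrite rmorphD.
(* Only pairs of exponents with product [k] contribute. *)
move=> j _; case: eqP => _; last first.
  by exists 0; [exact: ideal_mul0|rewrite rmorph0 mulr0n].
have [b bfa bE] := u1 i; have [e efa eE] := IHn _ j u2.
exists (b * e); first exact: ideal_mulM.
by rewrite mulr1n rmorphM /= -bE -eE.
Qed.

Lemma frac_series_ideal_of_definition (fa : set R) l :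
  ideal_of_definition fa -> [set c | c \in I l] `<=` fa ->
  ideal_of_definition (@invlim_ball L sys 0 l : set A).
Proof.
move=> [_ _ fa_nil] lfa; split.
- exact: invlim_ball_ideal.
- exact: invlim_ball_open.
move=> V /(nbhs_invlimP fundamental_inhabited fundamental_directed)[m mV].
have [n n0 nm] := fa_nil _ (fundamental_nbhs m); exists n => // x xn.
(* Lifts are available only at levels refining [l], so the argument runs at a common refinement [k]
   and then descends to [m]. *)
have [k [lk mk]] := fundamental_directed l m.
apply: mV; apply/malgP => e; rewrite mcoeff0.
have [c /nm cm] := frac_coef_ideal_exp lk e lfa xn.
move=> /(frac_coef_compat mk); rewrite /frac_coef => ->.
by apply/eqP; rewrite -(rmorph0 (\pi)) -Quotient.idealrBE subr0.
Qed.

Theorem frac_series_admissible (fa : set R) :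
  ideal_of_definition fa -> admissible A.
Proof.
move=> fa_def; have [[fa0 _ _] fa_open _] := fa_def.
have inh := fundamental_inhabited; have dir := fundamental_directed.
(* Being open, [fa] contains some [I l]; this index gives the ideal of definition. *)
have [l lfa] := I_fund.2 fa (open_nbhs_nbhs (conj fa_open fa0)).
split.
- exact: (invlim_linearly_topologized inh dir).
- by exists (@invlim_ball L sys 0 l); exact: frac_series_ideal_of_definition lfa.
- exact: (invlim_hausdorff inh dir).
- exact: (invlim_complete inh dir).
Qed.

End FracSeriesAdmissible.

Theorem lemma5p8 (p : nat) (p_ge2 : (2 <= p)%N)
  (d : nat) (d_gt0 : (0 < d)%N)
  (A0 : preTopologicalComNzRingType) (a : A0) (A0a : eka_datum d a)
  (R_adm : admissible (eka d_gt0 a))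
  (fa : set (eka d_gt0 a)) (fa_def : ideal_of_definition fa)
  (r : nat) (r_gt0 : (0 < r)%N)
  (L : Type) (I : L -> idealr (eka d_gt0 a)) (I_fund : fundamental_system I) :
  admissible (frac_series p r I).
Proof. exact: (frac_series_admissible _ _ I_fund fa_def). Qed.
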